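(* Let $m,n\ge 1$ and let $p_1,\dots,p_m\ge 1$ be integers with $\sum_{i=1}^m p_i=n$. Let $A\in\mathbb{R}^{m\times n}$ be such that every $m$-order squared matrix of $A$ (with respect to this partition) is a normal matrix, belongs to the class $\mathbb{F}=\{S=(s_{ij}) : s_{ij}\ge 0 \text{ for all } i\ne j\}$, and is D-stable. Then there exists a block diagonal non-square matrix $K\in\mathbb{R}^{n\times m}$ (of the structure described in the context, with non-negative entries $k_{i,l}$) such that for every diagonal matrix $E=\mathrm{diag}(\varepsilon_{1,1},\dots,\varepsilon_{1,p_1},\dots,\varepsilon_{m,1},\dots,\varepsilon_{m,p_m})\in\mathbb{R}^{n\times n}$ with non-negative diagonal entries, and every non-empty index set $j\subseteq\{1,\dots,m\}$ such that for each $i\in j$ at least one of $\varepsilon_{i,1},\dots,\varepsilon_{i,p_i}$ is non-zero, all eigenvalues of the principal submatrix $[AEK]_j$ have positive real part: $$\mathrm{Re}\{\sigma_i([AEK]_j)\}>0\quad\text{for every } i .$$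
   Context: Partition of columns: given integers $p_1,\dots,p_m\ge 1$ with $\sum_i p_i=n$, the $n$ columns of $A\in\mathbb{R}^{m\times n}$ are relabelled in order as $A=[\boldsymbol{a}_{1,1},\dots,\boldsymbol{a}_{1,p_1},\boldsymbol{a}_{2,1},\dots,\boldsymbol{a}_{2,p_2},\dots,\boldsymbol{a}_{m,1},\dots,\boldsymbol{a}_{m,p_m}]$. $m$-order squared matrices of $A$: the $N=\prod_{i=1}^m p_i$ matrices $[\boldsymbol{a}_{1,\zeta_1},\boldsymbol{a}_{2,\zeta_2},\dots,\boldsymbol{a}_{m,\zeta_m}]\in\mathbb{R}^{m\times m}$ obtained by choosing one column $\boldsymbol{a}_{i,\zeta_i}$, $\zeta_i\in\{1,\dots,p_i\}$, from each group $i$. Block diagonal structure of $K$: $K$ is the $n\times m$ matrix whose $i$-th column has entries $k_{i,1},\dots,k_{i,p_i}$ (all non-negative) in the rows corresponding to group $i$ and zeros in all other rows. Consequently $AEK=[\sum_{l=1}^{p_1}\varepsilon_{1,l}k_{1,l}\boldsymbol{a}_{1,l},\dots,\sum_{l=1}^{p_m}\varepsilon_{m,l}k_{m,l}\boldsymbol{a}_{m,l}]\in\mathbb{R}^{m\times m}$. For a square matrix $M\in\mathbb{R}^{m\times m}$ and a non-empty index set $j\subseteq\{1,\dots,m\}$ (a $k$-tuple of distinct integers in $1,\dots,m$), $[M]_j$ denotes the principal submatrix of $M$ with rows and columns indexed by $j$; $\sigma_i(\cdot)$ denotes the $i$-th eigenvalue. Stability convention: a real square matrix is stable if all its eigenvalues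 have positive real part. A matrix $S\in\mathbb{R}^{m\times m}$ is D-stable if $DS$ is stable for every diagonal matrix $D$ with positive diagonal entries. A real matrix $S$ is normal if $SS^T=S^TS$. *)

(* Defs.v *)
From HB Require Import structures.
From mathcomp Require Import all_boot all_order all_algebra.
From mathcomp Require Import reals complex.

Set Implicit Arguments.
Unset Strict Implicit.
Unset Printing Implicit Defensive.

Import Order.TTheory GRing.Theory Num.Theory.
Local Open Scope ring_scope.

Section Matrices.
Variable R : realType.

(* Sign convention: eigenvalues in the open right half-plane. *)
Definition stable k (M : 'M[R]_k) : Prop :=
  forall z : R[i],
    eigenvalue (map_mx (real_complex R) M) z -> 0 < complex.Re z.

Definition D_stable k (S : 'M[R]_k) : Prop :=
  forall d : 'rV[R]_k, (forall i, 0 < d 0 i) -> stable (diag_mx d *m S).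

Definition normal_mx k (S : 'M[R]_k) : Prop := S *m S^T = S^T *m S.

Definition class_F k (S : 'M[R]_k) : Prop :=
  forall i j, i != j -> 0 <= S i j.

Definition principal_submx k (M : 'M[R]_k) (j : {set 'I_k}) : 'M[R]_#|j| :=
  mxsub (@enum_val _ (mem j)) (@enum_val _ (mem j)) M.

Section Partition.
Variables (m n : nat) (p : 'I_m -> nat) (hn : (\sum_(i < m) p i)%N = n).

(* tagnat.Rank numbers the pairs (i, l), l < p i, lexicographically: the value
   of group_index i l is p 0 + ... + p (i - 1) + l. *)
Definition group_index (i : 'I_m) (l : 'I_(p i)) : 'I_n :=
  cast_ord hn (@tagnat.Rank m p i l).

Definition squared_mx (A : 'M[R]_(m, n)) (zeta : forall i, 'I_(p i)) : 'M[R]_m :=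
  \matrix_(r, i) A r (group_index (zeta i)).

Definition nonneg_block_diagonal (K : 'M[R]_(n, m)) : Prop :=
  exists k : forall i, 'I_(p i) -> R,
    (forall i l, 0 <= k i l) /\
    (forall i l i', K (@group_index i l) i' = if i' == i then k i l else 0).

End Partition.
End Matrices.

(* Main.v *)
Require Import Defs.
From HB Require Import structures.
From mathcomp Require Import all_boot all_order all_algebra.
From mathcomp Require Import reals complex.
From mathcomp Require Import sesquilinear spectral ring.

Set Implicit Arguments.
Unset Strict Implicit.
Unset Printing Implicit Defensive.

Import Order.TTheory GRing.Theory Num.Theory.
Local Open Scope ring_scope.

(** The block indicator K, all of whose k_{i,l} are 1, works for every E.

    A stable normal matrix S has a positive definite quadratic form: in a
    unitary eigenbasis x S x^T is a combination of the eigenvalues with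
    nonnegative weights, and for real x only their real parts survive
    ([normal_stable_form_gt0]).  D-stability of a squared matrix with D the
    identity thus gives sum_i x_i (x . a_{i,zeta_i}) > 0 for all nonzero x and
    all choices zeta.

    For i in j, the number W_i = sum_l eps_{i,l} is positive, and the i-th
    column of AEK is W_i times a convex combination of the a_{i,l}.  For a fixed x
    supported in j, the i-th term of the form above is, as a function of
    zeta_i, at least as small for a minimizing column as on average
    ([min_le_average]); since zeta may depend on x, and the terms may be
    minimized independently of each other, the matrix with columns
    (AEK)_i / W_i inherits a positive form on vectors supported in j.

    It remains to restore the factors W_i.  If the form sum_i d_i x_i (x B)_i
    is positive definite for some weights d_i >= 0, then all the eigenvalues of
    B have positive real part ([weighted_form_stable], and
    [principal_submx_stable] for principal submatrices).  This is applied to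
    B = AEK with d_i = 1 / W_i. *)

Lemma conjC_real_complex (R : rcfType) (a : R) :
  Num.conj (real_complex R a) = real_complex R a.
Proof. by apply: conj_Creal; rewrite complex_real. Qed.

Lemma Re_real_complexM (R : rcfType) (z : R[i]) (a : R) :
  complex.Re (z * real_complex R a) = complex.Re z * a.
Proof. by case: z => x y /=; rewrite mulr0 subr0. Qed.

Lemma Im_real_complexM (R : rcfType) (z : R[i]) (a : R) :
  complex.Im (z * real_complex R a) = complex.Im z * a.
Proof. by case: z => x y /=; rewrite mulr0 add0r mulrC. Qed.

Lemma map_mx_Re_mul (R : rcfType) k (v : 'rV[R[i]]_k) (B : 'M[R]_k) :
  map_mx (@complex.Re R) (v *m map_mx (real_complex R) B) =
  map_mx (@complex.Re R) v *m B.
Proof.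
apply/rowP => i; rewrite !mxE.
rewrite (big_morph (@complex.Re R) (id1 := 0) (op1 := +%R)) => [|[? ?] [? ?]|] //.
by apply: eq_bigr => l _; rewrite !mxE Re_real_complexM.
Qed.

Lemma map_mx_Im_mul (R : rcfType) k (v : 'rV[R[i]]_k) (B : 'M[R]_k) :
  map_mx (@complex.Im R) (v *m map_mx (real_complex R) B) =
  map_mx (@complex.Im R) v *m B.
Proof.
apply/rowP => i; rewrite !mxE.
rewrite (big_morph (@complex.Im R) (id1 := 0) (op1 := +%R)) => [|[? ?] [? ?]|] //.
by apply: eq_bigr => l _; rewrite !mxE Im_real_complexM.
Qed.

(** If v = x + i y is an eigenvector for z, then the real part of
    conj(v_i) (v B)_i = z |v_i|^2 is x_i (x B)_i + y_i (y B)_i.  Summing with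
    the weights d writes Re z times a nonnegative number as the sum of the
    forms at x and y, one of which is nonzero. *)
Lemma weighted_form_stable (R : realType) k (B : 'M[R]_k) (d : 'I_k -> R) :
    (forall i, 0 <= d i) ->
    (forall x : 'rV_k, x != 0 -> 0 < \sum_i d i * (x 0 i * (x *m B) 0 i)) ->
  stable B.
Proof.
move=> d_ge0 posB z /eigenvalueP [v vB v_neq0].
pose x := map_mx (@complex.Re R) v; pose y := map_mx (@complex.Im R) v.
pose Q (w : 'rV[R]_k) := \sum_i d i * (w 0 i * (w *m B) 0 i).
have Q_ge0 w : 0 <= Q w.
  have [->|w_neq0] := eqVneq w 0; last exact: ltW (posB _ w_neq0).
  by rewrite /Q big1 // => i _; rewrite mxE mul0r mulr0.
have Qxy_gt0 : 0 < Q x + Q y.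
  have [x0|x_neq0] := eqVneq x 0; last exact: ltr_pwDl (posB _ x_neq0) _.
  have [y0|y_neq0] := eqVneq y 0; last exact: ltr_wpDl (posB _ y_neq0).
  case/eqP: v_neq0; apply/rowP => i; move/rowP/(_ i): x0; move/rowP/(_ i): y0.
  by rewrite !mxE; case: (v 0 i) => a b /= -> ->.
have QxyE : Q x + Q y =
    complex.Re z * \sum_i d i * (x 0 i ^+ 2 + y 0 i ^+ 2).
  rewrite /Q -big_split mulr_sumr; apply: eq_bigr => i _ /=.
  rewrite -map_mx_Re_mul -map_mx_Im_mul vB !mxE.
  by case: z (v 0 i) {vB} => a b [s t] /=; ring.
rewrite ltNge; apply/negP => z_le0; move: Qxy_gt0; apply/negP; rewrite -leNgt.
rewrite QxyE; apply: mulr_le0_ge0 => //; apply: sumr_ge0 => i _.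
by rewrite mulr_ge0 ?addr_ge0 ?sqr_ge0.
Qed.

(** With S = P^* diag(la) P and P unitary, the vector u = x P^* gives
    x S x^T = sum_i la_i |u_i|^2, because the transpose of a real x is also its
    adjoint.  The left side is real, hence equal to the sum of the
    Re(la_i) |u_i|^2, and each la_i is an eigenvalue of S. *)
Lemma normal_stable_form_gt0 (R : realType) k (S : 'M[R]_k) (x : 'rV_k) :
    normal_mx S -> stable S -> x != 0 -> 0 < \sum_i x 0 i * (x *m S) 0 i.
Proof.
move=> normS stabS x_neq0.
pose toC := real_complex R.
pose M := map_mx toC S.
have conjM m n (N : 'M[R]_(m, n)) : map_mx Num.conj (map_mx toC N) = map_mx toC N.
  by apply/matrixP => i j; rewrite !mxE conjC_real_complex.
have normM : M \is normalmx.
  by apply/normalmxP; rewrite !map_trmx conjM -!map_mxM normS.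
have /orthomx_spectralP := normM.
set P := spectralmx M; set la := spectral_diag M.
have Punitary : P \is unitarymx := spectral_unitarymx M.
rewrite invmx_unitary // => ME.
pose u := map_mx toC x *m map_mx Num.conj P^T.
(* The rows of P are left eigenvectors: P S = diag(la) P. *)
have la_gt0 i : 0 < complex.Re (la 0 i).
  apply: stabS; apply/eigenvalueP; exists (row i P).
    rewrite -/M {1}ME -row_mul !mulmxA (unitarymxP Punitary) mul1mx.
    by rewrite row_mul row_diag_mx -scalemxAl -rowE.
  apply/eqP => Pi0; have /rowP/(_ i)/eqP := congr1 (row i) (unitarymxP Punitary).
  by rewrite row_mul Pi0 mul0mx !mxE eqxx eq_sym oner_eq0.
have u_neq0 : u != 0.
  apply: contraNneq x_neq0 => u0.
  have Pu : map_mx Num.conj P^T *m P = 1%:M by exact/mulmx1C/unitarymxP.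
  by rewrite -(map_mx_eq0 toC) -[map_mx toC x]mulmx1 -Pu mulmxA -/u u0 mul0mx.
have xSx : toC (\sum_i x 0 i * (x *m S) 0 i) = \sum_i la 0 i * `|u 0 i| ^+ 2.
  have -> : \sum_i x 0 i * (x *m S) 0 i = (x *m S *m x^T) 0 0.
    by rewrite [RHS]mxE; apply: eq_bigr => i _; rewrite [x^T _ _]mxE mulrC.
  transitivity ((map_mx toC (x *m S *m x^T)) 0 0); first by rewrite [RHS]mxE.
  rewrite !map_mxM -/M ME !mulmxA -/u.
  have -> : u *m diag_mx la *m P *m map_mx toC x^T =
            u *m diag_mx la *m map_mx Num.conj u^T.
    rewrite /u trmx_mul map_mxM -mulmxA map_trmx trmxK -map_mx_comp.
    rewrite (map_mx_id (@conjCK _)).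
    congr (_ *m (_ *m _)); apply/matrixP => a b.
    by rewrite !mxE; apply/esym/conjC_real_complex.
  rewrite mul_mx_diag mxE; apply: eq_bigr => i _; rewrite !mxE.
  by rewrite mulrAC mulrC -normCK.
have xSxRe : \sum_i x 0 i * (x *m S) 0 i =
    \sum_i complex.Re (la 0 i) * complex.Re `|u 0 i| ^+ 2.
  rewrite -[LHS]/(complex.Re (toC _)) xSx.
  rewrite (big_morph (@complex.Re R) (id1 := 0) (op1 := +%R)) => [|[? ?] [? ?]|] //.
  apply: eq_bigr => i _; rewrite -[in LHS](RRe_real (normr_real (u 0 i))).
  by rewrite -rmorphXn Re_real_complexM.
have /rV0Pn [i ui_neq0] := u_neq0.
rewrite xSxRe (bigD1 i) //= ltr_pwDl //.
  apply: mulr_gt0 (la_gt0 i) (exprn_gt0 2 _).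
  by move: ui_neq0; rewrite -normr_gt0 ltcE => /andP [_].
by apply: sumr_ge0 => l _; rewrite mulr_ge0 ?sqr_ge0 // ltW.
Qed.

(** Extending a vector indexed by j by zero turns the form of the principal
    submatrix into the form of B on vectors supported in j. *)
Lemma principal_submx_stable (R : realType) m (B : 'M[R]_m) (j : {set 'I_m})
    (d : 'I_m -> R) :
    (forall i, i \in j -> 0 <= d i) ->
    (forall x : 'rV_m, x != 0 -> (forall i, i \notin j -> x 0 i = 0) ->
       0 < \sum_(i in j) d i * (x 0 i * (x *m B) 0 i)) ->
  stable (principal_submx B j).
Proof.
move=> d_ge0 posB.
apply: (@weighted_form_stable _ _ _ (fun a => d (enum_val a))) => [a|x x_neq0].
  by apply: d_ge0; apply: enum_valP.
pose x' : 'rV[R]_m := \row_i \sum_(a | enum_val a == i) x 0 a.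
have x'E a : x' 0 (enum_val a) = x 0 a.
  rewrite mxE (bigD1 a) //= big1 ?addr0 // => b /andP [/eqP /enum_val_inj ->].
  by rewrite eqxx.
have x'_out i : i \notin j -> x' 0 i = 0.
  move=> i_out; rewrite mxE big1 // => a /eqP a_i.
  by move: i_out; rewrite -a_i enum_valP.
have x'_neq0 : x' != 0.
  apply: contraNneq x_neq0 => x'0; apply/eqP/rowP => a.
  by rewrite -x'E x'0 !mxE.
clearbody x'.
have x'B a : (x *m principal_submx B j) 0 a = (x' *m B) 0 (enum_val a).
  rewrite !mxE [RHS](bigID (mem j)) /= [X in _ = _ + X]big1 => [|i i_out].
    by rewrite addr0 [RHS]big_enum_val; apply: eq_bigr => b _; rewrite x'E mxE.
  by rewrite x'_out // mul0r.
have := posB x' x'_neq0 x'_out; rewrite big_enum_val.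
by under eq_bigr => a _ do rewrite x'E -x'B.
Qed.

Lemma big_group_index (V : nmodType) (m n : nat) (p : 'I_m -> nat)
    (hn : (\sum_(i < m) p i)%N = n) (F : 'I_n -> V) :
  \sum_c F c = \sum_i \sum_l F (@group_index m n p hn i l).
Proof.
case: n / hn F => F; rewrite sig_big_dep /= (reindex _ tagnat.sig_bij_on) /=.
by apply: eq_bigr => s _; rewrite /group_index cast_ord_id tagnat.sig2K.
Qed.

Lemma D_stable_stable (R : realType) k (S : 'M[R]_k) : D_stable S -> stable S.
Proof.
move=> /(_ (const_mx 1)); rewrite diag_const_mx mul1mx; apply=> i.
by rewrite mxE.
Qed.

Lemma min_le_average (R : realFieldType) (T : finType) (w f : T -> R) (l0 : T) :
    (forall l, 0 <= w l) -> 0 < \sum_l w l -> (forall l, f l0 <= f l) ->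
  f l0 <= (\sum_l w l)^-1 * \sum_l w l * f l.
Proof.
move=> w_ge0 W_gt0 f_min; rewrite mulrC ler_pdivlMr // mulr_sumr.
by apply: ler_sum => l _; rewrite mulrC ler_wpM2l.
Qed.

Theorem theorem2 (R : realType) (m n : nat) (hm : (1 <= m)%N) (hn1 : (1 <= n)%N)
    (p : 'I_m -> nat) (hp : forall i, (1 <= p i)%N)
    (hn : (\sum_(i < m) p i)%N = n)
    (A : 'M[R]_(m, n))
    (hA : forall zeta : (forall i, 'I_(p i)),
       normal_mx (squared_mx hn A zeta) /\
       class_F (squared_mx hn A zeta) /\
       D_stable (squared_mx hn A zeta)) :
  exists K : 'M[R]_(n, m),
    nonneg_block_diagonal hn K /\
    forall e : 'rV[R]_n, (forall c, 0 <= e 0 c) ->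
    forall j : {set 'I_m}, j != set0 ->
      (forall i, i \in j -> exists l : 'I_(p i), e 0 (group_index hn l) != 0) ->
      stable (principal_submx (A *m diag_mx e *m K) j).
Proof.
pose g i (l : 'I_(p i)) : 'I_n := group_index hn l.
pose grp (c : 'I_n) := tagnat.sig1 (cast_ord (esym hn) c).
have grpE i (l : 'I_(p i)) : grp (g i l) = i.
  by rewrite /grp /g /group_index cast_ordK tagnat.Rank1K.
pose K : 'M[R]_(n, m) := \matrix_(c, i) (grp c == i)%:R.
exists K; split.
  exists (fun _ _ => 1); split => [i l|i l i']; first exact: ler01.
  by rewrite mxE grpE eq_sym; case: eqP.
move=> e e_ge0 j _ e_j.
pose W i := \sum_l e 0 (g i l).
have W_gt0 i : i \in j -> 0 < W i.
  move=> /e_j [l el_neq0]; rewrite /W (bigD1 l) //= ltr_pwDl //.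
    by rewrite lt_def el_neq0 e_ge0.
  by apply: sumr_ge0 => l' _; apply: e_ge0.
have colE (x : 'rV[R]_m) i : (x *m (A *m diag_mx e *m K)) 0 i =
    \sum_l e 0 (g i l) * (x *m A) 0 (g i l).
  rewrite !mulmxA mul_mx_diag mxE.
  rewrite (big_group_index hn) (bigD1 i) //= [X in _ + X]big1 ?addr0 => [|i' i'i].
    by apply: eq_bigr => l _; rewrite !mxE -/(g i l) grpE eqxx mulr1 mulrC.
  apply: big1 => l _; rewrite !mxE -/(g i' l) grpE.
  by rewrite (negPf i'i) mulr0.
apply: (principal_submx_stable (d := fun i => (W i)^-1)) => [i i_j|x x_neq0 x_out].
  by rewrite invr_ge0 ltW // W_gt0.
(* The choice of columns depends on x: group by group, it minimizes the
   contribution of that group to the quadratic form at x. *)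
pose f i l := x 0 i * (x *m A) 0 (g i l).
pose zeta i : 'I_(p i) := [arg min_(l < Ordinal (hp i)) f i l]%O.
have zeta_min i l : f i (zeta i) <= f i l.
  by rewrite /zeta; case: arg_minP => // l' _; apply.
have [normS [_ DstabS]] := hA zeta.
apply: lt_le_trans (normal_stable_form_gt0 normS (D_stable_stable DstabS) x_neq0) _.
rewrite (bigID (mem j)) /= addrC big1 => [|i i_out]; last first.
  by rewrite x_out // mul0r.
rewrite add0r; apply: ler_sum => i i_j.
have -> : x 0 i * (x *m squared_mx hn A zeta) 0 i = f i (zeta i).
  by rewrite /f !mxE; congr (_ * _); apply: eq_bigr => r _; rewrite mxE.
rewrite colE mulr_sumr.
under eq_bigr => l _ do rewrite mulrCA -/(f i l).
by apply: min_le_average => //; apply: W_gt0.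
Qed.
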